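(* If a combinatorial proposition has a combinatorial proof, then it is true.
   Context: A graph $(V,E)$: finite $V$, $E$ a set of two-element subsets of $V$; write $vw$. A homomorphism $h:G\to G'$ satisfies $vw\in E(G)\Rightarrow h(v)h(w)\in E(G')$; it is a skew fibration if for every $v\in V(G)$ and every $w$ with $h(v)w\in E(G')$ there is $\hat w$ with $v\hat w\in E(G)$ and $h(\hat w)w\notin E(G')$. A cograph is a graph with nonempty vertex set such that for distinct $v,w,x,y$ the edges among $\{v,w,x,y\}$ are not exactly $\{vw,wx,xy\}$. Atoms: literals $p,\overline p$ (variables $p$) and constants $0,1$; $p,\overline p$ dual. A combinatorial proposition is a cograph with an atom label on each vertex. A stable set contains no edge; a clause is a maximal stable set; a clause is true if it contains a $1$-labelled vertex or two vertices labelled by dual literals; a labelled graph is true if all its clauses are true. A coloured graph has an equivalence relation $\sim$ on $V$ with $v\sim w$, $v\ne w$ implying $vw\notin E$; classes are colour classes. $W$ induces a matching if $W\ne\emptyset$ and each $w\in W$ has a unique $w'\in W$ with $ww'\in E$. Nicely coloured: every colour class has at most two vertices and no union of two-vertex colour classes induces a matching. A combinatorial proof of a combinatorial proposition $P$ is a skew fibration $h:C\to P$ from a nicely coloured cograph $C$ whose colour classes are axiomatic: a class $\{v\}$ with $h(v)$ labelled $1$, or a class $\{v,w\}$ with $h(v),h(w)$ labelled by dual literals. *)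

(* Defs.v *)
From mathcomp Require Import all_boot.

Set Implicit Arguments.
Unset Strict Implicit.
Unset Printing Implicit Defensive.

Record graph := Graph {
  vertex :> finType;
  edge : rel vertex;
  edge_sym : symmetric edge;
  edge_irr : irreflexive edge
}.

Definition homomorphism (G G' : graph) (h : G -> G') : Prop :=
  forall v w : G, edge v w -> edge (h v) (h w).

Definition skew_fibration (G G' : graph) (h : G -> G') : Prop :=
  homomorphism h /\
  forall (v : G) (w : G'), edge (h v) w ->
    exists2 w' : G, edge v w' & ~~ edge (h w') w.

Definition cograph (G : graph) : Prop :=
  0 < #|G| /\
  forall v w x y : G, uniq [:: v; w; x; y] ->
    ~~ [&& edge v w, edge w x, edge x y,
           ~~ edge v x, ~~ edge v y & ~~ edge w y].

Inductive atom (X : Type) : Type :=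
  | Pos of X
  | Neg of X
  | Zero
  | One.

Arguments Zero {X}.
Arguments One {X}.

(* Duality is between literals only: 0 and 1 are not dual to each other. *)
Definition dual (X : eqType) (a b : atom X) : bool :=
  match a, b with
  | Pos p, Neg q => p == q
  | Neg p, Pos q => p == q
  | _, _ => false
  end.

Record labelled_graph (X : Type) := LabelledGraph {
  underlying :> graph;
  label : underlying -> atom X
}.

Record combinatorial_proposition (X : Type) := CombinatorialProposition {
  labelled :> labelled_graph X;
  labelled_cograph : cograph labelled
}.

Definition stable (G : graph) (A : {set G}) : bool :=
  [forall v in A, forall w in A, ~~ edge v w].

Definition clause (G : graph) (A : {set G}) : bool :=
  maxset (@stable G) A.

Definition clause_true (X : eqType) (G : labelled_graph X) (A : {set G}) :
    Prop :=
  (exists2 v : G, v \in A & label v = One) \/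
  (exists v w : G, [/\ v \in A, w \in A & dual (label v) (label w)]).

Definition graph_true (X : eqType) (G : labelled_graph X) : Prop :=
  forall A : {set G}, clause A -> clause_true A.

Record coloured_graph := ColouredGraph {
  uncoloured :> graph;
  colour : rel uncoloured;
  colour_refl : reflexive colour;
  colour_sym : symmetric colour;
  colour_trans : transitive colour;
  colour_edge : forall v w : uncoloured,
    colour v w -> v != w -> ~~ edge v w
}.

Definition colour_classes (C : coloured_graph) : {set {set C}} :=
  equivalence_partition (@colour C) [set: C].

Definition induces_matching (G : graph) (W : {set G}) : Prop :=
  W != set0 /\
  forall w : G, w \in W -> exists! w' : G, w' \in W /\ edge w w'.

Definition nicely_coloured (C : coloured_graph) : Prop :=
  (forall K : {set C}, K \in colour_classes C -> #|K| <= 2) /\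
  (forall S : {set {set C}},
     S \subset [set K in colour_classes C | #|K| == 2] ->
     ~ induces_matching (cover S)).

Definition axiomatic (X : eqType) (C : coloured_graph) (P : labelled_graph X)
    (h : C -> P) (K : {set C}) : Prop :=
  (exists2 v : C, K = [set v] & label (h v) = One) \/
  (exists2 vw : C * C,
     K = [set vw.1; vw.2] & dual (label (h vw.1)) (label (h vw.2))).

Record combinatorial_proof (X : eqType) (P : combinatorial_proposition X)
    (C : coloured_graph) (h : C -> P) : Prop := CombinatorialProof {
  proof_cograph : cograph C;
  proof_nice : nicely_coloured C;
  proof_skew : skew_fibration h;
  proof_axiomatic :
    forall K : {set C}, K \in colour_classes C -> axiomatic h K
}.

(* Main.v *)
Require Import Defs.
From mathcomp Require Import all_boot zify.

(** Let [h : C -> P] be a combinatorial proof and [A] a clause of [P].  The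
    preimage of [A] is stable because [h] is a homomorphism, and it is in fact
    a maximal stable set of [C]: this is shown by induction on the decomposition
    of the cograph [P] into disjoint unions and joins, the skew fibration
    property passing to the preimage of each part.  Finally, a maximal stable
    set of a nicely coloured cograph contains a whole colour class, since
    otherwise a minimal alternating cycle of colour pairs and edges leaving the
    stable set would be an induced matching. *)

Set Implicit Arguments.
Unset Strict Implicit.
Unset Printing Implicit Defensive.

(** * Decomposition of cographs by disjoint union and join *)

(** Bare relations instead of graphs, so that complements, which are not irreflexive, are covered
    too. *)
Definition P4_free (T : finType) (r : rel T) : Prop :=
  forall a b c d : T, uniq [:: a; b; c; d] ->
    ~~ [&& r a b, r b c, r c d, ~~ r a c, ~~ r a d & ~~ r b d].

(** The value [false] of [b] stands for a disjoint union, [true] for a join. *)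
Definition homogeneous (T : finType) (r : rel T) (b : bool) (D1 D2 : {set T}) :
    Prop :=
  forall x y, x \in D1 -> y \in D2 -> r x y = b.

Definition splits (T : finType) (r : rel T) (D : {set T}) : Prop :=
  exists b D1 D2, [/\ D = D1 :|: D2, D1 != set0, D2 != set0,
                      [disjoint D1 & D2] & homogeneous r b D1 D2].

Lemma homogeneousC (T : finType) (r : rel T) (b : bool) (D1 D2 : {set T}) :
  symmetric r -> homogeneous r b D1 D2 -> homogeneous r b D2 D1.
Proof. by move=> r_sym hom x y xD yD; rewrite r_sym hom. Qed.

(** The path on four vertices is self-complementary: [a b c d] turns into [c a d b]. *)
Lemma P4_free_compl (T : finType) (r : rel T) :
  symmetric r -> P4_free r -> P4_free (fun x y => ~~ r x y).
Proof.
move=> r_sym r_free a b c d abcd_uniq; apply/negP.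
case/and5P=> rab rbc rcd; rewrite !negbK => rac /andP[rad rbd].
have /r_free/negP[] : uniq [:: c; a; d; b].
  by rewrite (perm_uniq (_ : perm_eq _ [:: a; b; c; d])) //;
     apply/permP=> p /=; lia.
by rewrite (r_sym c a) rac rad (r_sym d b) rbd rcd rab (r_sym c b) rbc.
Qed.

Lemma splits_compl (T : finType) (r : rel T) (D : {set T}) :
  splits (fun x y => ~~ r x y) D -> splits r D.
Proof.
case=> b [D1 [D2 [defD D1_n0 D2_n0 dis hom]]]; exists (~~ b), D1, D2.
split=> // x y xD yD; by rewrite -(hom x y) // negbK.
Qed.

Lemma homogeneous_splits (T : finType) (r : rel T) (b : bool)
    (D1 D2 : {set T}) (x y : T) :
  x \in D1 -> y \in D2 -> [disjoint D1 & D2] -> homogeneous r b D1 D2 ->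
  splits r (D1 :|: D2).
Proof.
move=> xD yD dis hom; exists b, D1, D2; split=> //; apply/set0Pn.
  by exists x.
by exists y.
Qed.

(* If [D1] and [D2] are non-adjacent and [x] has a neighbour [c] in [D2], then
   an edge of [D1] joining a neighbour of [x] to a non-neighbour of [x]
   would start an induced path through [x] and [c]; so the non-neighbours of
   [x] in [D1] can be split off. *)
Lemma splits_off_non_neighbours (T : finType) (r : rel T) (D1 D2 : {set T})
    (x m c : T) :
  symmetric r -> P4_free r -> x \notin D1 -> x \notin D2 ->
  [disjoint D1 & D2] -> homogeneous r false D1 D2 ->
  m \in D1 -> ~~ r x m -> c \in D2 -> r x c ->
  splits r (x |: (D1 :|: D2)).
Proof.
move=> r_sym r_free xD1 xD2 dis hom mD1 xm cD2 xc.
pose M := [set z in D1 | ~~ r x z].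
have -> : x |: (D1 :|: D2) = M :|: (x |: (D1 :\: M :|: D2)).
  apply/setP=> z; rewrite !inE.
  by case: (z == x); case: (z \in D1); case: (z \in D2); case: (r x z).
apply: (@homogeneous_splits _ _ false _ _ m x).
- by rewrite !inE mD1.
- by rewrite !inE eqxx.
- apply/pred0P=> z /=; rewrite !inE; case zD1: (z \in D1) => //=.
  rewrite (disjointFr dis zD1) orbF; case: eqP zD1 => [->|_ _].
    by rewrite (negPf xD1).
  by case: (r x z).
move=> b z; rewrite !inE => /andP[bD1 xb].
case/or3P => [/eqP->|/andP[xz zD1]|zD2]; last exact: hom.
  by rewrite r_sym; apply: negbTE.
rewrite zD1 /= negbK in xz; apply/negP => bz.
have bc := hom _ _ bD1 cD2; have zc := hom _ _ zD1 cD2.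
have neq u v : u \in D1 -> v \notin D1 -> u != v.
  by move=> uD; apply: contraNneq => <-.
have cD1 : c \notin D1 by rewrite (disjointFl dis cD2).
have /r_free/negP[] : uniq [:: b; z; x; c].
  have b_z : b != z by apply: contraNneq xb => ->.
  have x_c : x != c by apply: contraNneq xD2 => ->.
  by rewrite /= !inE !negb_or b_z x_c !(neq b) // !(neq z).
by rewrite bz (r_sym z) xz xc (r_sym b) xb bc zc.
Qed.

(** A part with no neighbour of [x] splits off. Otherwise a non-neighbour in either part reduces to
    [splits_off_non_neighbours]; if there is none, [x] is joined to everything. *)
Lemma splits_add_vertex (T : finType) (r : rel T) (D1 D2 : {set T})
    (x d e : T) :
  symmetric r -> P4_free r -> x \notin D1 -> x \notin D2 ->
  d \in D1 -> e \in D2 ->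
  [disjoint D1 & D2] -> homogeneous r false D1 D2 ->
  splits r (x |: (D1 :|: D2)).
Proof.
move=> r_sym r_free xD1 xD2 dD1 eD2 dis hom.
have isolated (E1 E2 : {set T}) (y z : T) :
    x \notin E1 -> x \notin E2 -> y \in E1 -> z \in E2 ->
    [disjoint E1 & E2] -> homogeneous r false E1 E2 ->
    {in E1, forall y', ~~ r x y'} -> splits r (x |: (E1 :|: E2)).
  move=> xE1 xE2 yE zE disE homE xE.
  rewrite setUCA; apply: (@homogeneous_splits _ _ false _ _ y x) => //.
  - by rewrite !inE eqxx.
  - rewrite -setI_eq0 setIUr setU_eq0 !setI_eq0 disE disjoint_sym.
    by rewrite disjoints1 xE1.
  move=> a b aE; rewrite !inE => /predU1P[->|bE]; last exact: homE.
  by rewrite r_sym; apply/negbTE/xE.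
have homC := homogeneousC r_sym hom.
have disC : [disjoint D2 & D1] by rewrite disjoint_sym.
have [/exists_inP[c2 c2D xc2] | /exists_inPn D2N] :=
  boolP [exists c in D2, r x c]; last first.
  by rewrite (setUC D1); apply: (isolated _ _ e d).
have [/exists_inP[c1 c1D xc1] | /exists_inPn D1N] :=
  boolP [exists c in D1, r x c]; last exact: (isolated _ _ d e).
have [/exists_inP[m mD xm] | /exists_inPn D1A] :=
  boolP [exists m in D1, ~~ r x m].
  exact: (@splits_off_non_neighbours _ _ _ _ x m c2).
have [/exists_inP[m mD xm] | /exists_inPn D2A] :=
  boolP [exists m in D2, ~~ r x m].
  by rewrite (setUC D1); apply: (@splits_off_non_neighbours _ _ _ _ x m c1).
apply: (@homogeneous_splits _ _ true _ _ x d); rewrite ?inE ?eqxx ?dD1 //.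
  by rewrite disjoints1 !inE negb_or xD1.
move=> y z /set1P-> /setUP[zD|zD]; apply/negPn; first exact: D1A.
exact: D2A.
Qed.

Lemma P4_free_splits (T : finType) (r : rel T) (D : {set T}) :
  symmetric r -> P4_free r -> 1 < #|D| -> splits r D.
Proof.
move=> r_sym r_free; have [n leDn] := ubnP #|D|.
elim: n => // n IH in D leDn * => D_gt1.
have /card_gt0P[x xD] : 0 < #|D| by apply: leq_trans D_gt1.
have D'_gt0 : 0 < #|D :\ x| by move: D_gt1; rewrite (cardsD1 x) xD.
have D'_lt : #|D :\ x| < n by move: leDn; rewrite (cardsD1 x) xD.
rewrite -(setD1K xD); have := setD11 x D; move: D'_gt0 D'_lt.
move: (D :\ x) => {xD D_gt1 leDn}D; rewrite leq_eqVlt => /predU1P[D_eq1 _ xD|].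
  have /esym/eqP/cards1P[y defD] := D_eq1.
  rewrite {}defD inE in xD *.
  apply: (@homogeneous_splits _ _ (r x y) _ _ x y); rewrite ?inE ?disjoints1 //.
    by rewrite inE xD.
  by move=> _ _ /set1P-> /set1P->.
move=> D_gt1 /IH/(_ D_gt1)[b [D1 [D2 [-> D1_n0 D2_n0 dis hom]]]].
have [[d dD] [e eD]] := (set0Pn _ D1_n0, set0Pn _ D2_n0).
move/negbT; rewrite inE negb_or => /andP[xD1 xD2].
(* A join becomes a disjoint union in the complement, which reduces [true] to [false]. *)
case: b hom => hom; last exact: (@splits_add_vertex _ _ _ _ x d e).
apply: splits_compl; apply: (@splits_add_vertex _ _ _ _ x d e) => //.
- by move=> y z; rewrite r_sym.
- exact: P4_free_compl.
by move=> y z yD zD; rewrite hom.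
Qed.

(** Induction along a cotree, whose leaves are the vertices and whose inner nodes carry [b]. *)
Lemma cotree_ind (T : finType) (r : rel T) (Q : {set T} -> Prop) :
  symmetric r -> P4_free r ->
  (forall x, Q [set x]) ->
  (forall b D1 D2, D1 != set0 -> D2 != set0 -> homogeneous r b D1 D2 ->
     Q D1 -> Q D2 -> Q (D1 :|: D2)) ->
  forall D, D != set0 -> Q D.
Proof.
move=> r_sym r_free Q1 QU D; have [n leDn] := ubnP #|D|.
elim: n => // n IH in D leDn *; rewrite -card_gt0 leq_eqVlt.
case/predU1P=> [/esym/eqP/cards1P[x ->] // | D_gt1].
have [b [D1 [D2 [defD D1_n0 D2_n0 dis hom]]]] :=
  P4_free_splits r_sym r_free D_gt1.
rewrite defD (cardsU D1 D2) (disjoint_setI0 dis) cards0 subn0 ltnS in leDn *.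
have:= D1_n0; have:= D2_n0; rewrite -!card_gt0 => D1_gt0 D2_gt0.
by apply: (QU b) => //; apply: IH => //; lia.
Qed.

(** Any two vertices of an induced path differ in adjacency to some vertex, so distinctness comes
    for free. *)
Lemma no_induced_P4 (G : graph) (a b c d : G) :
  P4_free (@edge G) -> edge a b -> edge b c -> edge c d ->
  edge a c = false -> edge a d = false -> edge b d = false -> False.
Proof.
move=> G_free ab bc cd ac ad bd.
have neq (x y z : G) : edge x z -> edge y z = false -> x != y.
  by move=> xz yz; apply: contraTneq xz => ->; rewrite yz.
have a_b : a != b by rewrite (neq a b b) ?edge_irr.
have b_c : b != c by rewrite (neq b c c) ?edge_irr.
have c_d : c != d by rewrite (neq c d d) ?edge_irr.
have a_c : a != c by rewrite eq_sym (neq c a d).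
have a_d : a != d by rewrite (neq a d b) // edge_sym.
have b_d : b != d by rewrite (neq b d a) 1?edge_sym // edge_sym.
have /G_free/negP[] : uniq [:: a; b; c; d].
  by rewrite /= !inE !negb_or a_b a_c a_d b_c b_d c_d.
by rewrite ab bc cd ac ad bd.
Qed.

(** * Preimages of clauses under skew fibrations *)

(** Maximal stable sets of the subgraph induced on [D], with maximality written as domination. *)
Definition clause_in (G : graph) (A D : {set G}) : Prop :=
  [/\ A \subset D, forall x y, x \in A -> y \in A -> ~~ edge x y &
      forall x, x \in D -> x \notin A -> exists2 y, y \in A & edge x y].

(** A [y] in [D2] dominating a vertex of [D1] would by homogeneity be adjacent to [a] as well,
    although [A] is stable. *)
Lemma clause_in_meet (G : graph) (b : bool) (A D1 D2 : {set G}) (a : G) :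
  homogeneous (@edge G) b D1 D2 -> clause_in A (D1 :|: D2) ->
  a \in A -> a \in D1 -> clause_in (A :&: D1) D1.
Proof.
move=> hom [sAD stA maxA] aA aD; split=> [|x y|x xD]; first exact: subsetIr.
  by move=> /setIP[xA _] /setIP[yA _]; apply: stA.
rewrite inE xD andbT => /maxA[|y yA xy]; first by rewrite inE xD.
exists y => //; rewrite inE yA /=.
have /setUP[//|yD] := subsetP sAD _ yA.
by have:= stA a y aA yA; rewrite (hom a y) // -(hom x y) // xy.
Qed.

(** Skew fibration between the subgraphs induced on [U] and [D]; the homomorphism condition is left
    to [h] itself. *)
Definition skew_between (G H : graph) (h : G -> H) (U : {set G}) (D : {set H}) :
    Prop :=
  (forall u, u \in U -> h u \in D) /\
  (forall u w, u \in U -> w \in D -> edge (h u) w ->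
     exists2 u', u' \in U & edge u u' && ~~ edge (h u') w).

Section Preimage.

Variables (G H : graph) (h : G -> H).
Hypotheses (h_hom : homomorphism h) (G_free : P4_free (@edge G)).
Hypothesis H_free : P4_free (@edge H).

(** A lift [u'] over [D2] of an edge within [D1] would force a join, and then [h u'] would be
    adjacent to [w]. *)
Lemma skew_between_meet (b : bool) (U : {set G}) (D1 D2 : {set H}) :
  homogeneous (@edge H) b D1 D2 -> skew_between h U (D1 :|: D2) ->
  skew_between h (U :&: h @^-1: D1) D1.
Proof.
move=> hom [hU skU]; split=> [u|u w]; first by rewrite !inE => /andP[].
rewrite !inE => /andP[uU uD] wD uw.
have [|u' u'U /andP[uu' u'w]] := skU u w uU _ uw; first by rewrite inE wD.
exists u'; last by rewrite uu'.
rewrite !inE u'U /=; have /setUP[//|u'D] := hU _ u'U.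
have E := h_hom uu'; rewrite (hom _ _ uD u'D) in E.
by rewrite edge_sym (hom _ _ wD u'D) E in u'w.
Qed.

Lemma clause_in_set1 (A : {set H}) (x : H) : clause_in A [set x] -> x \in A.
Proof.
case=> sAx _ maxA; apply/negPn/negP => xA; have [|y yA] := maxA x _ xA.
  by rewrite inE.
by have /set1P-> := subsetP sAx _ yA; rewrite edge_irr.
Qed.

Lemma clause_in_neq0 (A D : {set H}) (x : H) :
  clause_in A D -> x \in D -> exists y, y \in A.
Proof.
case=> _ _ maxA xD; have [xA|/(maxA x xD)[y yA _]] := boolP (x \in A).
  by exists x.
by exists y.
Qed.

Lemma preimage_clause_neq0 (U : {set G}) (A D : {set H}) :
  skew_between h U D -> clause_in A D -> U != set0 ->
  exists2 u, u \in U & h u \in A.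
Proof.
move=> skU clA /set0Pn[u uU].
have D_n0 : D != set0.
  by apply/set0Pn; exists (h u); case: skU => hU _; apply: hU.
move: D D_n0 U A u skU clA uU.
apply: (cotree_ind (@edge_sym H) H_free)
  => [x|b D1 D2 D1_n0 D2_n0 hom IH1 IH2] U A u skU clA uU.
  exists u => //; have [/(_ u uU)/set1P-> _] := skU; exact: clause_in_set1.
have step E1 E2 a v : homogeneous (@edge H) b E1 E2 ->
    (forall (U : {set G}) (A : {set H}) u, skew_between h U E1 ->
       clause_in A E1 -> u \in U -> exists2 u, u \in U & h u \in A) ->
    skew_between h U (E1 :|: E2) -> clause_in A (E1 :|: E2) ->
    a \in A -> a \in E1 -> v \in U -> h v \in E1 ->
    exists2 u, u \in U & h u \in A.
  move=> homE IH skE clE aA aE vU vE.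
  have [] :=
    IH _ _ v (skew_between_meet homE skE) (clause_in_meet homE clE aA aE).
    by rewrite !inE vU.
  by move=> w; rewrite !inE => /andP[wU _] /andP[wA _]; exists w.
wlog uD : D1 D2 D1_n0 D2_n0 hom IH1 IH2 skU clA / h u \in D1.
  move=> W; have [hU _] := skU; have /setUP[uD|uD] := hU u uU.
    exact: (W D1 D2).
  by apply: (W D2 D1); rewrite 1?setUC //; exact/homogeneousC/hom/edge_sym.
have huD : h u \in D1 :|: D2 by rewrite inE uD.
case: b hom step => hom step.
  (* Join: if [a] lies in the other part, lifting the edge from [h u] to [a] gives a vertex over the
     part of [a]. *)
  have [a aA] := clause_in_neq0 clA huD.
  have [sAD _ _] := clA; have /setUP[aD|aD] := subsetP sAD a aA.
    exact: (step D1 D2 a u).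
  have [_ skU2] := skU.
  have [||u' u'U /andP[_ u'a]] := skU2 u a uU.
  - by rewrite inE aD orbT.
  - exact: hom.
  apply: (step D2 D1 a u') => //; rewrite 1?setUC //.
    by exact/homogeneousC/hom/edge_sym.
  have [hU _] := skU; have /setUP[u'D|//] := hU u' u'U.
  by rewrite (hom _ _ u'D aD) in u'a.
(* Disjoint union: [A] meets the part of [h u], since only that part can dominate [h u]. *)
have [uA|uA] := boolP (h u \in A); first exact: (step D1 D2 (h u) u).
have [sAD _ maxA] := clA; have [a aA ua] := maxA _ huD uA.
have /setUP[aD|aD] := subsetP sAD a aA; first exact: (step D1 D2 a u).
by rewrite (hom _ _ uD aD) in ua.
Qed.

(* Here [v] stands for a vertex whose image is joined to all of [D], so that
   lifting the edges from [h v] to [D] gives the hypothesis.  In the disjoint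
   union case, if the neighbours of [v] meet the preimages of both parts, then
   they are themselves skew over [D]: a lift [x] of [m] not adjacent to [v]
   would start an induced path [x m v n], with [n] over the other part. *)
Lemma neighbour_preimage_clause (U : {set G}) (A D : {set H}) (v : G) :
  D != set0 -> skew_between h U D -> clause_in A D ->
  (forall w, w \in D -> exists2 u, u \in U & edge v u && ~~ edge (h u) w) ->
  exists2 u, u \in U & edge v u && (h u \in A).
Proof.
move=> D_n0; move: D D_n0 U A.
apply: (cotree_ind (@edge_sym H) H_free)
  => [x|b D1 D2 D1_n0 D2_n0 hom IH1 IH2] U A skU clA hit.
  have [|u uU /andP[vu _]] := hit x; first by rewrite inE.
  exists u => //; rewrite vu; have [/(_ u uU)/set1P-> _] := skU.
  exact: clause_in_set1.
have [hU skU2] := skU; have [sAD _ maxA] := clA.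
have step E1 E2 a : homogeneous (@edge H) b E1 E2 ->
    (forall (U : {set G}) (A : {set H}),
       skew_between h U E1 -> clause_in A E1 ->
       (forall w, w \in E1 ->
          exists2 u, u \in U & edge v u && ~~ edge (h u) w) ->
       exists2 u, u \in U & edge v u && (h u \in A)) ->
    skew_between h U (E1 :|: E2) -> clause_in A (E1 :|: E2) ->
    a \in A -> a \in E1 ->
    (forall w, w \in E1 ->
       exists2 u, u \in U & [&& edge v u, ~~ edge (h u) w & h u \in E1]) ->
    exists2 u, u \in U & edge v u && (h u \in A).
  move=> homE IH skE clE aA aE hitE.
  have [w /hitE[u uU]|u] :=
    IH _ _ (skew_between_meet homE skE) (clause_in_meet homE clE aA aE).
  - case/and3P=> vu uw uE.
    by exists u; rewrite ?vu // !inE uU.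
  - by rewrite !inE => /andP[uU _] /and3P[vu uA _]; exists u; rewrite ?vu.
case: b hom step => hom step.
  (* Join: a vertex of [D2] is adjacent to all of [D1], so what [hit] gives for [w] in [D1] lies
     over [D1]. *)
  have [d dD1] := set0Pn _ D1_n0; have dD : d \in D1 :|: D2 by rewrite inE dD1.
  have [a aA] := clause_in_neq0 clA dD; clear d dD1 dD D1_n0 D2_n0.
  wlog aD : D1 D2 hom IH1 IH2 skU clA sAD maxA hU skU2 hit / a \in D1.
    move=> W; have /setUP[aD|aD] := subsetP sAD a aA; first exact: (W D1 D2).
    by apply: (W D2 D1); rewrite 1?setUC //; exact/homogeneousC/hom/edge_sym.
  apply: (step D1 D2 a) => // w wD.
  have [|u uU /andP[vu uw]] := hit w; first by rewrite inE wD.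
  exists u => //; rewrite vu uw /=; have /setUP[//|uD] := hU u uU.
  by rewrite edge_sym (hom _ _ wD uD) in uw.
pose M := [set u in U | edge v u].
(* If no neighbour of [v] in [U] lies over [E2], then [hit] survives the restriction to [E1]. *)
have one_side E1 E2 e : homogeneous (@edge H) false E1 E2 ->
    (forall (U : {set G}) (A : {set H}),
       skew_between h U E1 -> clause_in A E1 ->
       (forall w, w \in E1 ->
          exists2 u, u \in U & edge v u && ~~ edge (h u) w) ->
       exists2 u, u \in U & edge v u && (h u \in A)) ->
    D1 :|: D2 = E1 :|: E2 -> e \in E1 ->
    (forall u, u \in M -> h u \notin E2) ->
    exists2 u, u \in U & edge v u && (h u \in A).
  move=> homE IH defD eE ME; rewrite {}defD in skU clA hit hU skU2 sAD maxA.
  have [a aA aE] : exists2 a, a \in A & a \in E1.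
    have [eA|eA] := boolP (e \in A); first by exists e.
    have [|a aA ea] := maxA e _ eA; first by rewrite inE eE.
    exists a => //; have /setUP[//|aE] := subsetP sAD a aA.
    by rewrite (homE _ _ eE aE) in ea.
  apply: (step E1 E2 a) => // w wE.
  have [|u uU /andP[vu uw]] := hit w; first by rewrite inE wE.
  exists u => //; rewrite vu uw; have /setUP[//|uE] := hU u uU.
  by have:= ME u; rewrite inE uU vu uE => /(_ isT).
have homC : homogeneous (@edge H) false D2 D1.
  by apply: homogeneousC hom; apply: edge_sym.
have [[d1 d1D] [d2 d2D]] := (set0Pn _ D1_n0, set0Pn _ D2_n0).
have [/exists_inP[m1 m1M m1D]|/exists_inPn M1] :=
  boolP [exists u in M, h u \in D1];
  last by apply: (one_side D2 D1 d2); rewrite 1?setUC.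
have [/exists_inP[m2 m2M m2D]|/exists_inPn M2] :=
  boolP [exists u in M, h u \in D2]; last exact: (one_side D1 D2 d1).
have liftM E1 E2 m n x : homogeneous (@edge H) false E1 E2 ->
    m \in M -> h m \in E1 -> n \in M -> h n \in E2 -> x \in U -> h x \in E1 ->
    edge m x -> x \in M.
  move=> homE; rewrite !inE => /andP[mU vm] mE /andP[nU vn] nE xU xE mx.
  rewrite xU /=; apply/negPn/negP => vx.
  have non y z : h y \in E1 -> h z \in E2 -> edge y z = false.
    by move=> yE zE; apply/negP => /h_hom; rewrite (homE _ _ yE zE).
  have xn := non x n xE nE; have mn := non m n mE nE.
  have xm : edge x m by rewrite edge_sym.
  have mv : edge m v by rewrite edge_sym.
  have xv : edge x v = false by rewrite edge_sym (negbTE vx).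
  exact: (no_induced_P4 G_free xm mv vn xv xn mn).
have skM : skew_between h M (D1 :|: D2).
  split=> [u|u w uM wD uw]; first by rewrite inE => /andP[/hU].
  have [uU vu] : u \in U /\ edge v u by move: uM; rewrite inE => /andP.
  have [x xU /andP[ux xw]] := skU2 u w uU wD uw.
  exists x; rewrite ?ux //; have hux := h_hom ux.
  have /setUP[uD|uD] := hU u uU; have /setUP[xD|xD] := hU x xU.
  - exact: (liftM D1 D2 u m2).
  - by rewrite (hom _ _ uD xD) in hux.
  - by rewrite (homC _ _ uD xD) in hux.
  exact: (liftM D2 D1 u m1).
(* All of [M] is adjacent to [v], so any vertex of [M] over [A] will do. *)
have [|u] := preimage_clause_neq0 skM clA; first by apply/set0Pn; exists m1.
by rewrite inE => /andP[uU vu] uA; exists u; rewrite ?vu.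
Qed.

(** Maximality gives [a] in [A] adjacent to [h v]. If both lie in one part, restrict to it;
    otherwise the parts are joined, the edges from [h v] to the part of [a] lift, and
    [neighbour_preimage_clause] applies. *)
Lemma preimage_clause_dominating (U : {set G}) (A D : {set H}) (v : G) :
  D != set0 -> skew_between h U D -> clause_in A D -> v \in U ->
  h v \notin A -> exists2 u, u \in U & edge v u && (h u \in A).
Proof.
move=> D_n0; move: D D_n0 U A.
apply: (cotree_ind (@edge_sym H) H_free)
  => [x|b D1 D2 D1_n0 D2_n0 hom IH1 IH2] U A skU clA vU vA.
  have [/(_ v vU)/set1P hv _] := skU.
  by rewrite hv (clause_in_set1 clA) in vA.
have [hU skU2] := skU; have [sAD _ maxA] := clA.
have [a aA va] := maxA _ (hU v vU) vA.
wlog aD : D1 D2 D1_n0 D2_n0 hom IH1 IH2 skU clA hU skU2 sAD maxA / a \in D1.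
  move=> W; have /setUP[aD|aD] := subsetP sAD a aA; first exact: (W D1 D2).
  by apply: (W D2 D1); rewrite 1?setUC //; exact/homogeneousC/hom/edge_sym.
have sk1 := skew_between_meet hom skU; have cl1 := clause_in_meet hom clA aA aD.
have [vD|vD] := boolP (h v \in D1).
  have [||u] := IH1 _ _ sk1 cl1; rewrite ?inE ?vU ?negb_and ?vA //.
  by move=> /andP[uU _] /and3P[vu uA _]; exists u; rewrite ?vu.
have vD2 : h v \in D2 by have:= hU v vU; rewrite inE (negPf vD).
have defb : b = true by rewrite -(hom _ _ aD vD2) edge_sym.
rewrite {}defb in hom.
have [w wD|u] := neighbour_preimage_clause (v := v) D1_n0 sk1 cl1.
  have [||u uU /andP[vu uw]] := skU2 v w vU; first by rewrite inE wD.
    by rewrite edge_sym hom.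
  exists u; rewrite ?vu // !inE uU /=; have /setUP[//|uD] := hU u uU.
  by rewrite edge_sym (hom _ _ wD uD) in uw.
by rewrite !inE => /andP[uU _] /and3P[vu uA _]; exists u; rewrite ?vu.
Qed.

End Preimage.

(** * Colour classes inside maximal stable sets *)

(** Take [D] minimal. Its image under any choice of successors is again closed, hence equal to [D],
    so every choice is injective. A second successor of [s] would yield a choice missing [f s]. *)
Lemma minimal_successor_closed (T : finType) (e : rel T) (S : {set T}) :
  S != set0 -> (forall s, s \in S -> exists2 t, t \in S & e s t) ->
  exists (D : {set T}) (f : T -> T),
    [/\ D \subset S, D != set0, {in D, forall s, f s \in D},
        {in D &, injective f} &
        {in D &, forall s t, e s t = (t == f s)}].
Proof.
pose closed_succ (D : {set T}) :=
  (D != set0) && [forall s in D, exists t in D, e s t].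
have closed_succP D f :
    D != set0 -> {in D, forall s, (f s \in D) && e s (f s)} -> closed_succ D.
  move=> D_n0 fD; rewrite /closed_succ D_n0.
  apply/forall_inP=> s /fD/andP[fs es].
  by apply/exists_inP; exists (f s).
move=> S_n0 succ; have [|D /minsetP[/andP[D_n0 succD] minD] sDS] :=
  @minset_exists _ closed_succ S.
  rewrite /closed_succ S_n0; apply/forall_inP=> s /succ[t tS st].
  by apply/exists_inP; exists t.
pose f s := odflt s [pick t in D | e s t].
have fD s : s \in D -> (f s \in D) && e s (f s).
  move=> sD; rewrite /f; case: pickP => //= none.
  by have /exists_inP[t tD st] := forall_inP succD s sD;
     have:= none t; rewrite tD st.
have onto g : {in D, forall s, (g s \in D) && e s (g s)} -> g @: D = D.
  move=> gD; have sgD : g @: D \subset D.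
    by apply/subsetP=> _ /imsetP[s /gD/andP[gs _] ->].
  apply: minD => //; apply: (closed_succP _ g).
    by have [s sD] := set0Pn _ D_n0; apply/set0Pn; exists (g s); apply: imset_f.
  move=> s /(subsetP sgD) sD; have /andP[_ ->] := gD s sD.
  by rewrite imset_f.
have inj g :
    {in D, forall s, (g s \in D) && e s (g s)} -> {in D &, injective g}.
  by move=> gD; apply/imset_injP; rewrite onto.
exists D, f; split=> // [s /fD/andP[]//||s t sD tD]; first exact: inj.
apply/idP/eqP=> [st|->]; last by have /andP[] := fD s sD.
pose g u := if u == s then t else f u.
have gD : {in D, forall u, (g u \in D) && e u (g u)}.
  by move=> u uD; rewrite /g; case: eqP => [->|_]; rewrite ?tD ?fD.
have : f s \in g @: D by rewrite onto //; have /andP[] := fD s sD.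
case/imsetP=> u uD; rewrite /g; case: eqP => [_ -> //|us fsu].
by case: us; apply: (inj f).
Qed.

(* Following [s |-> s' |-> t], where [s'] is the other vertex of the class of
   [s] and [t] is a neighbour of [s'] in [B], a minimal successor-closed set of
   vertices [s] gives an induced matching with edges [s' t]: a chord between
   [s'] and [t'] would be the middle edge of an induced path. *)
Lemma clause_contains_colour_class (C : coloured_graph) (B : {set C}) :
  P4_free (@edge C) -> nicely_coloured C -> B != set0 ->
  (forall x y, x \in B -> y \in B -> ~~ edge x y) ->
  (forall x, x \notin B -> exists2 y, y \in B & edge x y) ->
  exists2 K, K \in colour_classes C & K \subset B.
Proof.
move=> C_free [small no_match] B_n0 stB maxB.
have [/exists_inP[K KC KB]|/exists_inPn noK] :=
  boolP [exists K in colour_classes C, K \subset B]; first by exists K.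
pose cls s := [set t in [set: C] | colour s t].
have clsC s : cls s \in colour_classes C by apply/imsetP; exists s.
have clsE s t : (t \in cls s) = colour s t by rewrite !inE.
(* By [noK] the default is never taken; for [s] in [B] this is the other vertex of its class. *)
pose p s := odflt s [pick t | colour s t && (t \notin B)].
have pP s : colour s (p s) && (p s \notin B).
  rewrite /p; case: pickP => //= none; have /negP[] := noK _ (clsC s).
  apply/subsetP=> t; rewrite clsE => st; apply/negPn/negP=> tB.
  by have:= none t; rewrite st tB.
have pc s : colour s (p s) by case/andP: (pP s).
have pB s : p s \notin B by case/andP: (pP s).
have sp s : s \in B -> s != p s by move=> sB; apply: contraNneq (pB s) => <-.
have def_cls s : s \in B -> cls s = [set s; p s].
  move=> sB; apply/esym/eqP; rewrite eqEcard cards2 sp // small // andbT.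
  by apply/subsetP=> t /set2P[]->; rewrite clsE ?colour_refl.
have [|D [f [sDB D_n0 fD f_inj fE]]] :=
  @minimal_successor_closed _ (fun s t => edge (p s) t) B B_n0.
  by move=> s _; apply: maxB.
have DB s : s \in D -> s \in B by apply: (subsetP sDB).
case: (no_match [set cls s | s in D]).
  apply/subsetP=> _ /imsetP[s sD ->]; rewrite inE clsC def_cls ?DB //.
  by rewrite cards2 sp ?DB.
have coverE w : w \in cover [set cls s | s in D] <->
    exists2 s, s \in D & w = s \/ w = p s.
  split=> [/bigcupP[_ /imsetP[s sD ->]]|[s sD ws]].
    by rewrite def_cls ?DB // => /set2P; exists s.
  apply/bigcupP; exists (cls s); first exact: imset_f.
  by rewrite def_cls ?DB //; apply/set2P.
have pp s t : s \in D -> t \in D -> edge (p s) (p t) -> False.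
  move=> sD tD st; have [eq_st|neq_st] := eqVneq s t.
    by rewrite eq_st edge_irr in st.
  have ps u : u \in D -> edge (p u) (f u) by move=> uD; rewrite fE ?eqxx ?fD.
  apply: (@no_induced_P4 _ (f s) (p s) (p t) (f t) C_free) => //.
  - by rewrite edge_sym ps.
  - exact: ps.
  - rewrite edge_sym fE ?fD //; apply: contra_neqF neq_st => /eqP.
    exact: f_inj.
  - by apply/negbTE/stB; apply/DB/fD.
  by rewrite fE ?fD //; apply: contra_neqF neq_st => /eqP/esym; apply: f_inj.
(* Injectivity on the finite set [D] gives surjectivity, hence a partner for each vertex of [D]. *)
have f_onto t : t \in D -> exists2 s, s \in D & t = f s.
  move=> tD; apply/imsetP; suff -> : f @: D = D by [].
  apply/eqP; rewrite eqEcard (card_in_imset f_inj) leqnn andbT.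
  by apply/subsetP=> _ /imsetP[s sD ->]; apply: fD.
split.
  have [s sD] := set0Pn _ D_n0; apply/set0Pn; exists s; apply/coverE.
  by exists s; [|left].
(* The matching pairs [p s] with [f s]. *)
move=> w /coverE[s sD [->|->]].
  have [t tD defs] := f_onto s sD.
  exists (p t); split=> [|w' [/coverE[u uD [->|->]]]].
  - split; first by apply/coverE; exists t; [|right].
    by rewrite edge_sym fE // defs.
  - by rewrite (negbTE (stB _ _ (DB _ sD) (DB _ uD))).
  by rewrite edge_sym fE // defs => /eqP/f_inj-> //.
exists (f s); split=> [|w' [/coverE[u uD [->|->]]]].
- split; last by rewrite fE ?eqxx ?fD.
  by apply/coverE; exists (f s); [apply: fD|left].
- by rewrite fE // => /eqP->.
by move=> /pp[].
Qed.

(** * Soundness of combinatorial proofs *)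

Theorem theorem3 (X : eqType) (P : combinatorial_proposition X) :
  (exists (C : coloured_graph) (h : C -> P), combinatorial_proof h) ->
  graph_true P.
Proof.
case=> C [h [[C_gt0 C_free] nice [h_hom h_skew] h_ax]] A /maxsetP[stA maxA].
have [P_gt0 P_free] := labelled_cograph P.
have {}stA x y : x \in A -> y \in A -> ~~ edge x y.
  by move=> xA; apply: (forall_inP (forall_inP stA x xA)).
(* A vertex outside [A] without neighbours in [A] could be added to [A]. *)
have clA : clause_in A [set: P].
  split=> // x _ xA; apply/exists_inP; apply: contraNT xA => /exists_inPn xN.
  suff <- : x |: A = A by rewrite setU11.
  apply: maxA; last exact: subsetUr.
  apply/forall_inP=> y yA; apply/forall_inP=> z; move: yA.
  case/setU1P=> [->|yA] /setU1P[->|zA]; rewrite ?edge_irr //; last exact: stA.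
    exact: xN.
  by rewrite edge_sym xN.
have sk : skew_between h [set: C] [set: P].
  by split=> // u w _ _ /h_skew[u' uu' u'w]; exists u'; rewrite ?uu'.
pose B := h @^-1: A.
have domB x : x \notin B -> exists2 y, y \in B & edge x y.
  rewrite inE => xA; have P_n0 : [set: P] != set0 by rewrite -card_gt0 cardsT.
  have [y _ /andP[xy yA]] :=
    preimage_clause_dominating h_hom C_free P_free P_n0 sk clA (in_setT x) xA.
  by exists y; rewrite ?inE.
have B_n0 : B != set0.
  have [x _] := card_gt0P C_gt0; apply/set0Pn.
  by have [xB|/domB[y yB _]] := boolP (x \in B); [exists x | exists y].
have stB x y : x \in B -> y \in B -> ~~ edge x y.
  rewrite !inE => xA yA; apply/negP=> /h_hom.
  by apply/negP; apply: stA.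
have [K /h_ax axK KB] := clause_contains_colour_class C_free nice B_n0 stB domB.
case: axK KB => [[v -> hv]|[[v w] /= -> hvw]].
  by rewrite sub1set inE => vA; left; exists (h v).
rewrite subUset !sub1set !inE => /andP[vA wA]; right.
by exists (h v), (h w).
Qed.
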